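(* Let $G$ be a graph with vertex set $\{1,\dots,n\}$, let $F_1,F_2,\dotsc,F_m$ be pairwise disjoint forts of $G$, and let $x_1,x_2,\dotsc,x_m\in\mathbb{R}^n$ be vectors with $\operatorname{supp}(x_i)=F_i$ for each $i$. There exists $A\in\mathsf{Sym}(G)$ with $\{x_1,x_2,\dotsc,x_m\}\subseteq\operatorname{Nul}(A)$ if and only if, for each pair $i\neq j$, the bipartite graph formed by the edges of $G$ between $F_i$ and $F_j$ (vertex set $F_i\cup F_j$, with edges exactly the edges of $G$ having one endpoint in $F_i$ and the other in $F_j$) is bridgeless.
   Context: Graphs are finite and simple. $\mathsf{Sym}(G)$ is the set of real symmetric $n\times n$ matrices $A=[a_{ij}]$ whose graph is $G$, i.e. for $i\neq j$, $a_{ij}\neq 0$ if and only if $ij$ is an edge of $G$ (the diagonal entries are unrestricted). $\operatorname{Nul}(A)$ is the null space of $A$. The support of $x=(x_i)\in\mathbb{R}^n$ is $\operatorname{supp}(x)=\{i : x_i\neq 0\}$. A fort in $G$ is a nonempty subset $F \subseteq V(G)$ such that no vertex $v \in V(G)\setminus F$ has exactly one neighbor in $F$. A bridge is an edge whose removal increases the number of connected components, and a graph is bridgeless if it has no bridge (in particular a graph with no edges is bridgeless). *)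

(* Defs.v *)
From mathcomp Require Import all_boot all_order all_algebra.
From mathcomp Require Import reals.

Set Implicit Arguments.
Unset Strict Implicit.
Unset Printing Implicit Defensive.

Import GRing.Theory.
Local Open Scope ring_scope.

Record sgraph (T : finType) := SGraph {
  adj :> rel T;
  adj_sym : symmetric adj;
  adj_irr : irreflexive adj
}.

Definition components (T : finType) (G : sgraph T) : nat := n_comp G predT.

Definition del_edge_rel (T : finType) (G : sgraph T) (x y : T) : rel T :=
  fun u v => G u v && ([set u; v] != [set x; y]).

Lemma del_edge_sym (T : finType) (G : sgraph T) (x y : T) :
  symmetric (del_edge_rel G x y).
Proof. by move=> u v; rewrite /del_edge_rel (adj_sym G) setUC. Qed.

Lemma del_edge_irr (T : finType) (G : sgraph T) (x y : T) :
  irreflexive (del_edge_rel G x y).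
Proof. by move=> u; rewrite /del_edge_rel (adj_irr G). Qed.

Definition del_edge (T : finType) (G : sgraph T) (x y : T) : sgraph T :=
  SGraph (@del_edge_sym T G x y) (@del_edge_irr T G x y).

Definition is_bridge (T : finType) (G : sgraph T) (x y : T) : bool :=
  G x y && (components G < components (del_edge G x y))%N.

Definition bridgeless (T : finType) (G : sgraph T) : Prop :=
  forall x y : T, ~~ is_bridge G x y.

Definition between_rel (T : finType) (G : sgraph T) (A B : {set T}) :
    rel {v : T | v \in A :|: B} :=
  fun u v => G (val u) (val v) &&
    ((val u \in A) && (val v \in B) || (val u \in B) && (val v \in A)).

Arguments between_rel {T} G A B u v.

Lemma between_sym (T : finType) (G : sgraph T) (A B : {set T}) :
  symmetric (between_rel G A B).
Proof.
move=> u v; rewrite /between_rel (adj_sym G); congr (_ && _).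
by rewrite orbC andbC [X in _ || X]andbC.
Qed.

Lemma between_irr (T : finType) (G : sgraph T) (A B : {set T}) :
  irreflexive (between_rel G A B).
Proof. by move=> u; rewrite /between_rel (adj_irr G). Qed.

Definition between (T : finType) (G : sgraph T) (A B : {set T}) :
    sgraph {v : T | v \in A :|: B} :=
  SGraph (@between_sym T G A B) (@between_irr T G A B).

Definition is_fort (T : finType) (G : sgraph T) (F : {set T}) : Prop :=
  F != set0 /\ forall v, v \notin F -> #|[set u in F | G v u]| <> 1%N.

Definition SymG (R : nzRingType) (n : nat) (G : sgraph 'I_n) (A : 'M[R]_n) : Prop :=
  A^T = A /\ forall i j, i != j -> (A i j != 0) = G i j.

Definition supp (R : nzRingType) (n : nat) (x : 'cV[R]_n) : {set 'I_n} :=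
  [set i | x i 0 != 0].

Definition Nul (R : nzRingType) (n : nat) (A : 'M[R]_n) : {pred 'cV[R]_n} :=
  [pred x | A *m x == 0].

(* Main.v *)
Require Import Defs.
From mathcomp Require Import all_boot all_order all_algebra.
From mathcomp Require Import reals.
From mathcomp Require Import ring.

Set Implicit Arguments.
Unset Strict Implicit.
Unset Printing Implicit Defensive.

Import Order.TTheory GRing.Theory Num.Theory.

Local Open Scope ring_scope.

(** Say that a real function on ordered pairs of vertices is a circulation if
    it is antisymmetric, is supported on the edges, and has zero row sums: a
    flow without sources or sinks.  A bridge carries no circulation, since the
    net flow out of a component of the rest of the graph is zero; any other
    edge closes a cycle and so carries one ([bridgeless_circulation]).

    The theorem translates this into matrices.  If [A] is symmetric and
    annihilates [x i] and [x j], then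
      [A u v * (x i u * x j v - x j u * x i v)]
    is antisymmetric with zero row sums.  As the supports are disjoint, its
    factor on the right vanishes except between [F i] and [F j], where exactly
    one of its two products survives.  It is therefore a circulation of the
    bipartite graph that is nonzero on each edge, and there is no bridge.

    Conversely, the symmetric matrices that annihilate every [x i], and whose
    off-diagonal entries vanish outside the edges, form a vector space.  A
    generic element of it is nonzero at every edge, provided that for each edge
    some element is nonzero there ([simultaneously_nonzero]).  For an
    edge between two forts, divide a circulation through it by the factor above
    ([admissible_circulation]).  For every other edge take
    [a *m b^T + b *m a^T] with [a] and [b] orthogonal to all [x i]: a unit
    vector is orthogonal to them at a vertex outside all forts, and so is a
    suitable combination of the unit vectors at two vertices of one fort.  When
    only one end of the edge is in a fort, the fort condition supplies the
    second vertex ([admissible_fort_outside]). *)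

(** * Bridges and connectivity *)

Lemma connect_symG (T : finType) (G : sgraph T) : connect_sym G.
Proof. by apply: sym_connect_sym; apply: adj_sym. Qed.

Lemma connect_del_edge (T : finType) (G : sgraph T) (x y : T) :
  connect (del_edge G x y) x y -> connect (del_edge G x y) =2 connect G.
Proof.
move=> cxy u v; apply/idP/idP; apply: connect_sub => {u v} u v.
  by case/andP=> Guv _; apply: connect1.
move=> Guv; case Euv: ([set u; v] == [set x; y]); last first.
  by apply: connect1; rewrite /= /del_edge_rel Guv Euv.
have [uxy vxy] : u \in [set x; y] /\ v \in [set x; y].
  by rewrite -(eqP Euv) !inE !eqxx orbT.
have cyx : connect (del_edge G x y) y x by rewrite connect_symG.
by case/set2P: uxy => ->; case/set2P: vxy => ->; rewrite ?connect0.
Qed.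

(** Deleting an edge refines the components, so sending each component to the
    one that contains it is onto; when the number of components does not grow,
    this map is also injective, so the two ends of the edge stay together. *)
Lemma not_bridgeP (T : finType) (G : sgraph T) (x y : T) :
  G x y -> reflect (connect (del_edge G x y) x y) (~~ is_bridge G x y).
Proof.
move=> Gxy; rewrite /is_bridge Gxy -leqNgt; set H := del_edge G x y.
apply: (iffP idP) => [le_comp | cxy]; last first.
  rewrite /components (eq_n_comp (e' := G)) // => u v.
  exact: connect_del_edge.
have symG := connect_symG G; have symH := connect_symG H.
have subHG u v : connect H u v -> connect G u v.
  by apply: connect_sub => {}u {}v /andP[Guv _]; apply: connect1.
pose rH : {set T} := [set u | roots H u]; pose rG := [set u | roots G u].
have rootI u : fingraph.root G (fingraph.root H u) = fingraph.root G u.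
  apply/eqP; rewrite root_connect // symG; apply: subHG; exact: connect_root.
have imE : [set fingraph.root G u | u in rH] = rG.
  apply/setP=> u; rewrite !inE; apply/imsetP/idP => [[v _ ->]|ru].
    exact: roots_root.
  exists (fingraph.root H u); first by rewrite inE roots_root.
  by rewrite rootI; apply/esym/eqP.
have inj : {in rH &, injective (fingraph.root G)}.
  apply/imset_injP; rewrite eqn_leq leq_imset_card imE /=.
  move: le_comp; rewrite /components /n_comp_mem.
  by congr (_ <= _)%N; apply: eq_card => u; rewrite !inE andbT.
rewrite -root_connect //; apply/eqP/inj; rewrite ?inE ?roots_root //.
by rewrite !rootI; apply/eqP; rewrite root_connect // connect1.
Qed.

(** * Circulations *)

Section Circulations.

Variables (R : numFieldType) (T : finType).
Implicit Types (G : sgraph T) (f : T -> T -> R).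

Definition flow_on G f : Prop :=
  (forall u v, f v u = - f u v) /\ (forall u v, f u v != 0 -> G u v).

Definition circulation G f : Prop :=
  flow_on G f /\ forall u, \sum_v f u v = 0.

Definition arc_flow (a b u v : T) : R :=
  ((u == a) && (v == b))%:R - ((u == b) && (v == a))%:R.

Lemma arc_flow_on G a b : G a b -> flow_on G (arc_flow a b).
Proof.
move=> Gab; split=> u v.
  by rewrite /arc_flow opprB andbC [(v == b) && _]andbC.
rewrite /arc_flow; case: andP => [[/eqP-> /eqP->] // | _].
by case: andP => [[/eqP-> /eqP->] _ | _]; rewrite ?subrr ?eqxx // adj_sym.
Qed.

Lemma sum_arc_flow a b u :
  \sum_v arc_flow a b u v = (u == a)%:R - (u == b)%:R.
Proof.
have sum1 (c d : T) : \sum_v ((u == c) && (v == d))%:R = (u == c)%:R :> R.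
  rewrite (bigD1 d) //= eqxx andbT big1 ?addr0 // => v /negPf->.
  by rewrite andbF.
by rewrite big_split sumrN !sum1.
Qed.

Lemma unit_flow G a b : connect G a b ->
  exists2 f, flow_on G f &
    forall u, \sum_v f u v = (u == a)%:R - (u == b)%:R.
Proof.
case/connectP=> p; elim: p a => [|c p IHp] a /=.
  move=> _ ->; exists (fun _ _ => 0).
    by split=> [u v|u v]; rewrite ?oppr0 ?eqxx.
  by move=> u; rewrite subrr big1.
case/andP=> Gac /IHp{}IHp /IHp [f [fN fG] sumf].
have [gN gG] := arc_flow_on Gac.
exists (fun u v => arc_flow a c u v + f u v) => [|u].
  split=> u v /=; first by rewrite fN gN -opprD.
  apply: contraNT => nGuv.
  have /eqP-> : arc_flow a c u v == 0 by apply: contraNT nGuv; apply: gG.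
  by rewrite add0r; apply: contraNT nGuv; apply: fG.
by rewrite big_split /= sum_arc_flow sumf addrA subrK.
Qed.

(** No net flow leaves a set of vertices: the flow inside the set cancels by
    antisymmetry.  Applied to the component of [x] after deletion of [xy], all
    of whose outgoing flow is on the edge [xy]. *)
Lemma circulation_bridge G f x y : circulation G f -> G x y ->
  f x y != 0 -> connect (del_edge G x y) x y.
Proof.
move=> [[fN fG] sumf] Gxy; apply: contraNT => ncxy.
pose S := connect (del_edge G x y) x.
have inS : \sum_(u | S u) \sum_(v | S v) f u v = 0.
  apply/eqP; rewrite -eqNr; apply/eqP.
  rewrite [RHS]exchange_big /= -sumrN; apply: eq_bigr => u _.
  by rewrite -sumrN; apply: eq_bigr => v _; rewrite -fN.
have outS u v : S u -> ~~ S v -> f u v != 0 -> (u == x) && (v == y).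
  move=> Su Sv /fG Guv; have Euv : [set u; v] == [set x; y].
    apply: contraNT Sv => Euv; apply: connect_trans Su (connect1 _).
    by rewrite /= /del_edge_rel Guv.
  have [uxy vxy] : u \in [set x; y] /\ v \in [set x; y].
    by rewrite -(eqP Euv) !inE !eqxx orbT.
  have Ny : u != y by apply: contraNneq ncxy => Euy; move: Su; rewrite Euy.
  have Nx : v != x by apply: contraNneq Sv => ->; apply: connect0.
  by move: uxy vxy; rewrite !inE (negPf Ny) (negPf Nx) orbF => ->.
have : \sum_(u | S u) \sum_v f u v = 0 by rewrite big1.
under eq_bigr => u _ do rewrite (bigID S) /=.
rewrite big_split /= inS add0r => <-; apply/eqP.
rewrite (bigD1 x) /=; last exact: connect0.
rewrite (bigD1 y) //= big1 => [|v /andP[Sv Nvy]]; last first.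
  apply: contraNeq Nvy => /outS.
  by rewrite /S connect0 => /(_ isT Sv)/andP[].
rewrite addr0 big1 ?addr0 // => u /andP[Su Nux]; apply: big1 => v Sv.
by apply: contraNeq Nux => /(outS u v Su Sv)/andP[].
Qed.

(** Conversely, a path avoiding the edge closes up with it into a cycle, along
    which a unit of flow circulates. *)
Lemma nonbridge_circulation G x y : G x y ->
  connect (del_edge G x y) x y ->
  exists2 f, circulation G f & f x y != 0.
Proof.
move=> Gxy /unit_flow[f [fN fH] sumf]; have [gN gG] := arc_flow_on Gxy.
exists (fun u v => f u v - arc_flow x y u v).
  split; last by move=> u; rewrite sumrB sumf sum_arc_flow subrr.
  split=> u v /=; first by rewrite fN gN -opprD.
  apply: contraNT => nGuv.
  have /eqP-> : arc_flow x y u v == 0 by apply: contraNT nGuv; apply: gG.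
  by rewrite subr0; apply: contraNT nGuv => /fH/andP[].
have /eqP-> : f x y == 0.
  by apply/negP=> /negP/fH; rewrite /= /del_edge_rel eqxx andbF.
have Nxy : x != y by apply: contraTneq Gxy => ->; rewrite adj_irr.
by rewrite /arc_flow !eqxx (negPf Nxy) subr0 sub0r oppr_eq0 oner_eq0.
Qed.

Lemma bridgeless_circulation G : bridgeless G <->
  forall x y, G x y -> exists2 f, circulation G f & f x y != 0.
Proof.
split=> [brG x y Gxy | circG x y].
  by apply: nonbridge_circulation => //; apply/not_bridgeP.
have [Gxy|] := boolP (G x y); last by rewrite /is_bridge => /negPf->.
have [f fG nz] := circG x y Gxy.
exact/(not_bridgeP Gxy)/(circulation_bridge fG).
Qed.

End Circulations.

(** The bipartite graphs live on a subtype of the vertices, whereas matrices are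
    indexed by all of them. *)
Section ZeroExtension.

Variables (R : numFieldType) (T : finType) (D : {set T}).
Variables (G : sgraph {v : T | v \in D}).
Variable f : {v : T | v \in D} -> {v : T | v \in D} -> R.

Definition zero_ext (i j : T) : R :=
  if insub i is Some u then if insub j is Some v then f u v else 0 else 0.

Lemma zero_ext_val u v : zero_ext (val u) (val v) = f u v.
Proof. by rewrite /zero_ext !valK. Qed.

Lemma zero_ext_neq0 i j : zero_ext i j != 0 ->
  exists u v, [/\ i = val u, j = val v & f u v != 0].
Proof.
rewrite /zero_ext; case: insubP => [u _ <-|]; last by rewrite eqxx.
by case: insubP => [v _ <-|]; [exists u, v | rewrite eqxx].
Qed.

Lemma zero_ext_antisym : circulation G f ->
  forall i j, zero_ext j i = - zero_ext i j.
Proof.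
move=> [[fN _] _] i j; rewrite /zero_ext.
by case: (insub i) => [u|]; case: (insub j) => [v|]; rewrite ?oppr0.
Qed.

Lemma sum_zero_ext : circulation G f -> forall i, \sum_j zero_ext i j = 0.
Proof.
move=> [_ sumf] i.
rewrite -(@big_rmcond _ _ _ _ _ (mem D)) => [|j Dj]; last first.
  by rewrite /zero_ext; case: insub => // u; rewrite insubN.
rewrite big_sub /zero_ext; case: insub => [u|]; last by rewrite big1.
by rewrite -[RHS](sumf u); apply: eq_bigr => v _; rewrite valK.
Qed.

End ZeroExtension.

(** * Generic vectors *)

(** A vector space over an infinite field is not a finite union of proper
    subspaces: [t *: a + b], for large [t], stays off every hyperplane that
    does not contain both [a] and [b]. *)
Lemma simultaneously_nonzero (R : numFieldType) (V : lmodType R)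
    (W : V -> Prop) (I : Type) (phi : I -> V -> R) (s : seq I) :
    (forall i, scalar (phi i)) ->
    W 0 -> (forall t a b, W a -> W b -> W (t *: a + b)) ->
    (forall i, exists2 a, W a & phi i a != 0) ->
  exists2 a, W a & all (fun i => phi i a != 0) s.
Proof.
move=> lin W0 Wlin nz; elim: s => [|i s [b Wb nzb]]; first by exists 0.
have [a Wa nza] := nz i.
(* the hyperplane of index j is hit only at t = - phi j b / phi j a *)
pose r j : R := `|phi j b / phi j a|.
have r_ge0 j : 0 <= r j by exact: normr_ge0.
have sum_ge0 l : 0 <= \sum_(j <- l) r j by apply: sumr_ge0.
pose t : R := 1 + \sum_(j <- i :: s) r j.
exists (t *: a + b); first exact: Wlin.
have good j : r j < t -> (phi j a != 0) || (phi j b != 0) ->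
    phi j (t *: a + b) != 0.
  rewrite lin; have [-> _ /= | nzja ltrt _] := eqVneq (phi j a) 0.
    by rewrite mulr0 add0r.
  apply: contraTneq ltrt => /eqP; rewrite addr_eq0 => /eqP tE.
  have t_ge0 : 0 <= t by rewrite addr_ge0.
  have -> : r j = t.
    rewrite /r -[phi j b]opprK -tE mulNr mulfK // normrN.
    by rewrite ger0_norm.
  by rewrite ltxx.
have lt_t u : u <= \sum_(j <- i :: s) r j -> u < t.
  by move=> le_u; apply: le_lt_trans le_u _; rewrite ltrDr ltr01.
rewrite /= good ?nza //=; last first.
  by apply: lt_t; rewrite big_cons lerDl.
(* each index of s has r j < t, so that good applies to all of them *)
have : all (fun j => r j <= \sum_(j <- s) r j) s.
  elim: (s) => //= j s' IHs; rewrite !big_cons lerDl sum_ge0 /=.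
  by apply: sub_all IHs => k le_k; apply: le_trans le_k _; rewrite lerDr.
move: nzb; elim: (X in all _ X -> all _ X -> all _ X) => //= j s' IHs.
case/andP=> nzj nzs /andP[lej les]; rewrite IHs // andbT.
apply: good; last by rewrite nzj orbT.
by apply: lt_t; rewrite big_cons; apply: le_trans lej _; rewrite lerDr.
Qed.

(** * Symmetric matrices annihilating prescribed vectors *)

Section NullVectors.

Variables (R : numFieldType) (n : nat) (G : sgraph 'I_n) (m : nat).
Variable x : 'I_m -> 'cV[R]_n.
Hypothesis x_disjoint :
  forall i j, i != j -> [disjoint supp (x i) & supp (x j)].

Lemma x_eq0 i j u : i != j -> u \in supp (x i) -> x j u 0 = 0.
Proof.
by move=> /x_disjoint/disjointFr dis /dis; rewrite inE => /negbFE/eqP.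
Qed.

(** Edges may carry a zero entry, unlike in [SymG]; this makes the condition
    linear. *)
Definition admissible (A : 'M[R]_n) : Prop :=
  [/\ A^T = A, forall u v, u != v -> A u v != 0 -> G u v
    & forall i, A *m x i = 0].

Lemma admissible0 : admissible 0.
Proof. by split=> [|u v|i]; rewrite ?trmx0 ?mul0mx // mxE eqxx. Qed.

Lemma admissible_lin t A B :
  admissible A -> admissible B -> admissible (t *: A + B).
Proof.
move=> [sA gA xA] [sB gB xB]; split=> [|u v Nuv|i].
- by rewrite linearP /= sA sB.
- rewrite !mxE; apply: contraNT => nGuv.
  have /eqP-> : A u v == 0 by apply: contraNT nGuv; apply: gA.
  by rewrite mulr0 add0r; apply: contraNT nGuv; apply: gB.
- by rewrite mulmxDl -scalemxAl xA xB scaler0 addr0.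
Qed.

(** When [f] is a circulation between the supports of [x i] and [x j], dividing
    by the antisymmetric function [x i u * x j v - x j u * x i v] gives a
    symmetric matrix.  On each edge exactly one of the two products is nonzero,
    so that every row, applied to [x i] or [x j], is a multiple of the
    corresponding row sum of [f]. *)
Lemma admissible_circulation i j f : i != j ->
    circulation (between G (supp (x i)) (supp (x j))) f ->
  admissible (\matrix_(u, v)
    (zero_ext f u v / (x i u 0 * x j v 0 - x j u 0 * x i v 0))).
Proof.
move=> Nij circf; have [[_ fG] _] := circf.
set g := zero_ext f.
have gE u v : g u v != 0 -> G u v /\
    ((u \in supp (x i)) && (v \in supp (x j)) ||
     (u \in supp (x j)) && (v \in supp (x i))).
  by case/zero_ext_neq0=> a [b [-> -> /fG /andP[]]].
have sumg u : \sum_v g u v = 0 by apply: sum_zero_ext circf u.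
split=> [|u v _|k].
- apply/matrixP=> u v; rewrite !mxE /g (zero_ext_antisym circf).
  by rewrite mulNr -mulrN -invrN; congr (_ / _); ring.
- rewrite mxE => nz.
  by have /gE[] : g u v != 0 by apply: contraNneq nz => ->; rewrite mul0r.
apply/matrixP=> u c; rewrite ord1 !mxE; under eq_bigr => v _ do rewrite mxE.
pose q := if k == i then - (x j u 0)^-1
          else if k == j then (x i u 0)^-1 else 0.
have row v : g u v / (x i u 0 * x j v 0 - x j u 0 * x i v 0) * x k v 0
    = q * g u v.
  have [-> | /gE[_ uv]] := eqVneq (g u v) 0; first by rewrite !mul0r mulr0.
  rewrite /q; have Nji : j != i by rewrite eq_sym.
  case/orP: uv => /andP[u_ v_].
    have [nzu nzv] : x i u 0 != 0 /\ x j v 0 != 0 by move: u_ v_; rewrite !inE.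
    (* x j u = 0, and 0^-1 = 0 makes q vanish for k = i, as it should *)
    rewrite (x_eq0 Nij u_) (x_eq0 Nji v_) mulr0 subr0 invr0 oppr0.
    have [->|Nki] := eqVneq k i; first by rewrite (x_eq0 Nji v_) mulr0 mul0r.
    have [->|Nkj] := eqVneq k j; first by field; rewrite nzu.
    have Njk : j != k by rewrite eq_sym.
    by rewrite (x_eq0 Njk v_) mulr0 mul0r.
  have [nzu nzv] : x j u 0 != 0 /\ x i v 0 != 0 by move: u_ v_; rewrite !inE.
  rewrite (x_eq0 Nji u_) (x_eq0 Nij v_) mul0r sub0r invr0.
  have [->|Nki] := eqVneq k i; first by field; rewrite nzu.
  have Nik : i != k by rewrite eq_sym.
  rewrite (x_eq0 Nik v_) mulr0.
  by case: eqVneq => _; rewrite mul0r.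
by under eq_bigr => v _ do rewrite row; rewrite -mulr_sumr sumg mulr0.
Qed.

(** The row sums are [x i u * (A *m x j) u - x j u * (A *m x i) u], hence zero.
    Inside one support both products vanish, which leaves only the bipartite
    edges. *)
Lemma null_vectors_circulation i j A : SymG G A ->
    A *m x i = 0 -> A *m x j = 0 ->
  circulation (between G (supp (x i)) (supp (x j)))
    (fun a b => A (val a) (val b) *
       (x i (val a) 0 * x j (val b) 0 - x j (val a) 0 * x i (val b) 0)).
Proof.
move=> [sA gA] Ai Aj; set f := fun u v => A u v *
   (x i u 0 * x j v 0 - x j u 0 * x i v 0).
have sAE u v : A v u = A u v by rewrite -[in RHS]sA mxE.
have row k u : A *m x k = 0 -> \sum_v A u v * x k v 0 = 0.
  by move/matrixP/(_ u 0); rewrite !mxE.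
split; first split=> [a b|a b]; rewrite -/(f _ _).
- by rewrite /f sAE; ring.
- rewrite -/(f _ _) /= /between_rel => nz.
  have Nab : val a != val b.
    apply: contraNneq nz => ->.
    by rewrite /f mulrC [_ * x j _ _]mulrC subrr mul0r.
  rewrite -gA //; apply/andP; split.
    by apply: contraNneq nz => A0; rewrite /f A0 mul0r.
  apply: contraNT nz; rewrite negb_or !negb_and !inE !negbK /f.
  by case/andP=> /orP[]/eqP-> /orP[]/eqP->; rewrite ?(mul0r, mulr0) subrr mulr0.
move=> a; rewrite -(big_sub _ (fun v => f (val a) v)) big_rmcond => [|v].
  pose u := val a; rewrite -/u.
  have fE v : f u v = x i u 0 * (A u v * x j v 0) - x j u 0 * (A u v * x i v 0).
    by rewrite /f; ring.
  under eq_bigr => v _ do rewrite fE.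
  by rewrite sumrB -!mulr_sumr !row // !mulr0 subrr.
rewrite !inE negb_or !negbK /f => /andP[/eqP-> /eqP->].
by rewrite !mulr0 subrr mulr0.
Qed.

Lemma sym_prod_admissible (a b : 'cV[R]_n) :
    (forall i, a^T *m x i = 0) -> (forall i, b^T *m x i = 0) ->
    (forall u v, u != v -> a u 0 != 0 -> b v 0 != 0 -> G u v) ->
  admissible (a *m b^T + b *m a^T).
Proof.
move=> ax bx abG; split=> [|u v Nuv|i].
- by rewrite linearD /= !trmx_mul !trmxK addrC.
- rewrite !mxE !big_ord1 !mxE; apply: contraNT => nGuv.
  have ab0 w z : w != z -> ~~ G w z -> a w 0 * b z 0 = 0.
    move=> Nwz; apply: contraNeq.
    by rewrite mulf_eq0 negb_or => /andP[]; apply: abG.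
  by rewrite ab0 // mulrC ab0 ?addr0 // 1?eq_sym // adj_sym.
- by rewrite mulmxDl -!mulmxA ax bx !mulmx0 addr0.
Qed.

Lemma delta_orthogonal v : (forall k, v \notin supp (x k)) ->
  forall k, (delta_mx v 0 : 'cV[R]_n)^T *m x k = 0.
Proof.
move=> vN k; rewrite trmx_delta -rowE; apply/rowP=> c; rewrite ord1 !mxE.
by apply/eqP; have := vN k; rewrite inE negbK.
Qed.

(** The combination of two unit vectors that is orthogonal to [x i]. *)
Definition swap_vec (i : 'I_m) (u w : 'I_n) : 'cV[R]_n :=
  x i w 0 *: delta_mx u 0 - x i u 0 *: delta_mx w 0.

Lemma swap_vecE i u w v :
  swap_vec i u w v 0 = x i w 0 * (v == u)%:R - x i u 0 * (v == w)%:R.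
Proof. by rewrite !mxE !andbT. Qed.

Lemma swap_vec_orthogonal i u w : u \in supp (x i) -> w \in supp (x i) ->
  forall k, (swap_vec i u w)^T *m x k = 0.
Proof.
move=> ui wi k; rewrite /swap_vec linearB /= mulmxBl !linearZ /= -!scalemxAl.
rewrite !trmx_delta -!rowE; apply/rowP=> c; rewrite ord1 !mxE.
have [->|Nki] := eqVneq k i; first by rewrite mulrC subrr.
have Nik : i != k by rewrite eq_sym.
by rewrite (x_eq0 Nik ui) (x_eq0 Nik wi) !mulr0 subrr.
Qed.

Hypothesis x_fort : forall i, is_fort G (supp (x i)).

(** In a fort, a neighbour of an outside vertex is never alone, so there is a
    second neighbour to balance it. *)
Lemma admissible_fort_outside i u v : u \in supp (x i) ->
    (forall k, v \notin supp (x k)) -> G u v ->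
  exists2 A, admissible A & A u v != 0.
Proof.
move=> ui vN Guv; have [_ /(_ v (vN i)) card_ne1] := x_fort i.
have [w wi [Nwu Gvw]] : exists2 w, w \in supp (x i) & w != u /\ G v w.
  pose S := [set w in supp (x i) | G v w].
  have [/existsP[w /andP[Nwu]]|] := boolP [exists w, (w != u) && (w \in S)].
    by rewrite inE => /andP[wi Gvw]; exists w.
  move=> /existsPn Su; case: card_ne1; apply/eqP/cards1P; exists u.
  apply/setP=> w; have := Su w; rewrite in_set1 /S.
  have [->|_ /=] := eqVneq w u; last by move/negPf.
  by move: (ui); rewrite !inE adj_sym Guv => ->.
have out z : z \in supp (x i) -> (z == v) = false.
  by move=> zi; apply/negP=> /eqP Ezv; move: (vN i); rewrite -Ezv zi.
exists (swap_vec i u w *m (delta_mx v 0)^T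
        + delta_mx v 0 *m (swap_vec i u w)^T).
  apply: sym_prod_admissible; first exact: swap_vec_orthogonal.
    exact: delta_orthogonal.
  move=> a b _; rewrite swap_vecE !mxE andbT.
  have [-> _ | _] := eqVneq a u.
    by case: (eqVneq b v) => [->|_]; rewrite ?eqxx.
  have [->|_] := eqVneq a w; last by rewrite !mulr0 subrr eqxx.
  by move=> _; case: (eqVneq b v) => [->|_]; rewrite ?eqxx // adj_sym.
rewrite [X in X != _]mxE [X in X + _]mxE [X in _ + X]mxE !big_ord1.
rewrite ![_^T _ _]mxE !swap_vecE !mxE (out u) // [u == w]eq_sym (negPf Nwu).
rewrite !eqxx /=.
by rewrite !mulr0 !mulr1 mul0r subr0 addr0; move: wi; rewrite inE.
Qed.

Lemma admissible_edge u v :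
    (forall i j, i != j -> bridgeless (between G (supp (x i)) (supp (x j)))) ->
    G u v ->
  exists2 A, admissible A & A u v != 0.
Proof.
move=> brl Guv.
have Nuv : u != v by apply: contraTneq Guv => ->; rewrite adj_irr.
have inorout w :
    (exists i, w \in supp (x i)) \/ (forall i, w \notin supp (x i)).
  have [/existsP|/existsPn] := boolP [exists i, w \in supp (x i)].
    by left.
  by right.
have [[i ui]|uN] := inorout u; have [[j vj]|vN] := inorout v.
- have [Eij|Nij] := eqVneq i j.
    subst j; pose d := swap_vec i u v.
    have d_orth : forall k, d^T *m x k = 0 by apply: swap_vec_orthogonal.
    exists (d *m d^T + d *m d^T).
      apply: sym_prod_admissible => // a b; rewrite /d !swap_vecE.
      have [->|_] := eqVneq a u; last have [->|_] := eqVneq a v.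
      - have [->|_] := eqVneq b u; first by rewrite ?eqxx.
        by have [->|_] := eqVneq b v; rewrite // !mulr0 subrr eqxx.
      - have [->|_] := eqVneq b u; first by rewrite adj_sym.
        have [->|_] := eqVneq b v; first by rewrite ?eqxx.
        by rewrite !mulr0 subrr eqxx.
      - by rewrite !mulr0 subrr eqxx.
    rewrite mxE -mulr2n mulrn_eq0 /= mxE big_ord1 [_^T _ _]mxE /d !swap_vecE.
    rewrite !eqxx [v == u]eq_sym (negPf Nuv) !mulr0 !mulr1 sub0r subr0.
    rewrite mulf_eq0 negb_or oppr_eq0.
    by move: ui vj; rewrite !inE => -> ->.
  set D := supp (x i) :|: supp (x j).
  have [uD vD] : u \in D /\ v \in D by rewrite !in_setU ui vj orbT.
  pose a : {w | w \in D} := Sub u uD; pose b : {w | w \in D} := Sub v vD.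
  have Hab : between G (supp (x i)) (supp (x j)) a b.
    by rewrite /= /between_rel !SubK Guv ui vj.
  have /bridgeless_circulation/(_ a b Hab) := brl _ _ Nij.
  move=> /(_ R) [f circf nz].
  exists (\matrix_(u, v)
    (zero_ext f u v / (x i u 0 * x j v 0 - x j u 0 * x i v 0))).
    exact: admissible_circulation.
  rewrite mxE -[u in zero_ext _ u]/(val a) -[v in zero_ext _ _ v]/(val b).
  rewrite zero_ext_val mulf_neq0 // invr_eq0 (x_eq0 Nij ui) mul0r subr0.
  by move: ui vj; rewrite !inE => ui vj; rewrite mulf_neq0.
- exact: admissible_fort_outside ui vN Guv.
- rewrite adj_sym in Guv.
  have [A admA nz] := admissible_fort_outside vj uN Guv.
  by exists A => //; have [sA _ _] := admA; rewrite -sA mxE.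
pose e w : 'cV[R]_n := delta_mx w 0.
exists (e u *m (e v)^T + e v *m (e u)^T).
  apply: sym_prod_admissible; try exact: delta_orthogonal.
  move=> a b _; rewrite !mxE !andbT.
  by have [->|_] := eqVneq a u; have [->|_] := eqVneq b v; rewrite ?eqxx.
rewrite /e !trmx_delta !mul_delta_mx !mxE !eqxx (negPf Nuv) /= addr0.
exact: oner_neq0.
Qed.

End NullVectors.

Theorem theorem5p3 (R : realType) (n : nat) (G : sgraph 'I_n) (m : nat)
    (F : 'I_m -> {set 'I_n}) (x : 'I_m -> 'cV[R]_n)
    (F_fort : forall i, is_fort G (F i))
    (F_disjoint : forall i j, i != j -> [disjoint F i & F j])
    (x_supp : forall i, supp (x i) = F i) :
  (exists A : 'M[R]_n, SymG G A /\ forall i, x i \in Nul A) <->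
  (forall i j, i != j -> bridgeless (between G (F i) (F j))).
Proof.
have x_disj i j : i != j -> [disjoint supp (x i) & supp (x j)].
  by rewrite !x_supp; apply: F_disjoint.
have x_fort i : is_fort G (supp (x i)) by rewrite x_supp.
split=> [[A [symA nulA]] i j Nij | brl].
  have Ax k : A *m x k = 0 by apply/eqP; have := nulA k; rewrite inE.
  rewrite -!x_supp.
  apply/(bridgeless_circulation R) => a b /andP[Gab Fab].
  eexists; first exact: (null_vectors_circulation symA (Ax i) (Ax j)).
  have Nji : j != i by rewrite eq_sym.
  have [_ gA] := symA; rewrite mulf_neq0 //.
    by rewrite gA //; apply: contraTneq Gab => ->; rewrite adj_irr.
  case/orP: Fab => /andP[aF bF]; move: (aF) (bF); rewrite !inE => nza nzb.
    by rewrite (x_eq0 x_disj Nij aF) mul0r subr0 mulf_neq0.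
  by rewrite (x_eq0 x_disj Nji aF) mul0r sub0r oppr_eq0 mulf_neq0.
have brl' i j : i != j -> bridgeless (between G (supp (x i)) (supp (x j))).
  by rewrite !x_supp; apply: brl.
pose edge : finType := {e : 'I_n * 'I_n | G e.1 e.2}.
pose entry (e : edge) (A : 'M[R]_n) : R := A (val e).1 (val e).2.
have [|||e|A [sA gA xA] /allP nzA] := @simultaneously_nonzero R _
    (admissible G x) edge entry (enum edge).
- by move=> e t A B; rewrite /entry !mxE.
- exact: admissible0.
- exact: admissible_lin.
- exact: (admissible_edge x_disj x_fort brl' (valP e)).
exists A; split; last by move=> i; rewrite inE xA.
split=> // u v Nuv; apply/idP/idP; first exact: gA.
move=> Guv; have := nzA (exist _ (u, v) Guv : edge).
by rewrite mem_enum => /(_ isT).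
Qed.
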